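(* For every $a\in[0,+\infty]$ there exist a compact connected metric space $X$ and a pointwise periodic homeomorphism $f:X\to X$ such that $h_{\mathrm{pol}}(f)=a$.
   Context: A homeomorphism $f:X\to X$ of a compact metric space is pointwise periodic if for every $x\in X$ there is a positive integer $n(x)$ with $f^{n(x)}(x)=x$. Polynomial entropy: let $(X,d)$ be a compact metric space and $f:X\to X$ continuous. For $n\ge 1$ put $d_n^f(x,y)=\max_{0\le k\le n-1}d(f^k(x),f^k(y))$. A finite set $E\subset X$ is $(n,\varepsilon)$-separated if $d_n^f(x,y)\ge\varepsilon$ for all distinct $x,y\in E$; $\mathrm{sep}(n,\varepsilon)$ is the maximal cardinality of an $(n,\varepsilon)$-separated set. The polynomial entropy of $f$ is $h_{\mathrm{pol}}(f)=\lim_{\varepsilon\to0}\limsup_{n\to\infty}\frac{\log \mathrm{sep}(n,\varepsilon)}{\log n}\in[0,+\infty]$. *)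

(* Defs.v *)
From HB Require Import structures.
From mathcomp Require Import all_boot all_order all_algebra finmap.
From mathcomp Require Import all_classical all_reals all_analysis.

Set Implicit Arguments.
Unset Strict Implicit.
Unset Printing Implicit Defensive.

Import Order.TTheory GRing.Theory Num.Theory.
Import numFieldNormedType.Exports.

Local Open Scope classical_set_scope.
Local Open Scope ring_scope.

Definition homeomorphism (X Y : topologicalType) (f : X -> Y) : Prop :=
  exists g : Y -> X, [/\ cancel f g, cancel g f, continuous f & continuous g].

Definition pointwise_periodic (X : Type) (f : X -> X) : Prop :=
  forall x : X, exists2 n : nat, (0 < n)%N & iter n f x = x.

(* The neutral element 0 of the iterated maximum is harmless for n >= 1, since
   distances are nonnegative. *)
Definition bowen_dist (R : realType) (X : metricType R) (f : X -> X)
    (n : nat) (x y : X) : R :=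
  \big[Num.max/0]_(k < n) mdist (iter k f x) (iter k f y).

Definition separated_fset (R : realType) (X : metricType R) (f : X -> X)
    (n : nat) (e : R) (E : {fset X}) : Prop :=
  forall x y : X, x \in E -> y \in E -> x != y -> e <= bowen_dist f n x y.

(* For n >= 1, e > 0, X compact and f continuous, the cardinalities below are
   bounded, so that this supremum is a maximum. *)
Definition sep (R : realType) (X : metricType R) (f : X -> X)
    (n : nat) (e : R) : \bar R :=
  ereal_sup [set (#|` E|%:R)%:E | E in separated_fset f n e].

(* The limit exists in \bar R because sep f n e is nonincreasing in e. *)
Definition pol_entropy (R : realType) (X : metricType R) (f : X -> X) : \bar R :=
  lim (limn_esup (fun n : nat => lne (sep f n e) / (ln n%:R)%:E)%E
       @[e --> 0^'+]).

(* Main.v *)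
Require Import Defs.
From HB Require Import structures.
From mathcomp Require Import all_boot all_order all_algebra finmap.
From mathcomp Require Import all_classical all_reals all_analysis.
From mathcomp Require Import ring lra zify.

(** The space is a compact hedgehog: a base segment [0, 1] of fixed points and
    countably many spikes, all glued at 0. Spike [i] is projected to the base
    segment by [t |-> t * h i] and is kept at distance [t * w i] from it, so that
    the spikes accumulate only on the base segment when [w] tends to 0. A
    permutation of the spikes with finite orbits that preserves [w] and changes
    [h] by at most [w] induces a pointwise periodic homeomorphism.

    At scale [k] the spikes are the pairs (binary word of length [r k], phase):
    along an orbit, [h] reads the word cyclically at speed [2^-k], each letter
    taking time [2^(k+1)]. In time [n] the scales with [2^k] much larger than [n]
    look motionless and contribute boundedly many separated points, while all
    [2^(r k)] words are read, hence separated, once [2^(k+1) * r k <= n]. So the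
    growth of [sep] at time [2^k] is about [2^(r k)], up to powers of [k], and
    [r k] is taken to be the integer part of [a * k], or [k^2] if [a] is
    infinite. *)

Set Implicit Arguments.
Unset Strict Implicit.
Unset Printing Implicit Defensive.

Import Order.TTheory GRing.Theory Num.Theory.
Import numFieldNormedType.Exports.
Import metricType_numDomainType.

Local Open Scope classical_set_scope.
Local Open Scope ring_scope.

(** * The hedgehog and its metric *)

(* The point at height 0 is common to all spikes; it is represented on the base
   segment [None] only. *)
Definition spike_domain (R : realType) (I : choiceType) (x : option I * R) :=
  (0 <= x.2 <= 1) && ((x.1 == None) || (0 < x.2)).

Definition hedgehog (R : realType) (I : choiceType) (h : I -> R)
    (w : I -> {posnum R}) : Type :=
  {x : option I * R | spike_domain x}.

HB.instance Definition _ (R : realType) (I : choiceType) (h : I -> R)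
  (w : I -> {posnum R}) := Choice.on (hedgehog h w).

Section hedgehog_metric.
Context {R : realType} {I : choiceType} (h : I -> R) (w : I -> {posnum R}).
Implicit Types (o : option I) (x y z : hedgehog h w).

Definition spike_height o : R := oapp h 1 o.
Definition spike_weight o : R := oapp (fun i => (w i)%:num) 0 o.

Let pos (x : option I * R) := x.2 * spike_height x.1.
Let dep (x : option I * R) := x.2 * spike_weight x.1.

(** [pos] is the projection to the base segment. The second summand is the railway metric on depths:
    passing between two spikes costs going down to the base and up again. *)
Let predist (x y : option I * R) : R := `|pos x - pos y| +
  (if x.1 == y.1 then `|dep x - dep y| else dep x + dep y).

Definition hedgehog_dist x y : R := predist (val x) (val y).

Lemma spike_weight_ge0 o : 0 <= spike_weight o.
Proof. by case: o => //=. Qed.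

Let dep_ge0 x : 0 <= dep (val x).
Proof.
by case: x => -[ o t] /= /andP[/andP[t0 _] _]; rewrite mulr_ge0// spike_weight_ge0.
Qed.

Let dep_eq0 x : dep (val x) = 0 -> (val x).1 = None.
Proof.
case: x => -[[i|] t] //= /andP[_ t0]; rewrite /dep/= => /eqP.
by rewrite mulf_eq0 !gt_eqF.
Qed.

Let hedgehog_distxx x : hedgehog_dist x x = 0.
Proof. by rewrite /hedgehog_dist /predist eqxx !subrr normr0 addr0. Qed.

Let hedgehog_dist_sym x y : hedgehog_dist x y = hedgehog_dist y x.
Proof.
rewrite /hedgehog_dist /predist distrC; congr (_ + _).
by rewrite eq_sym; case: ifP; rewrite (distrC, addrC).
Qed.

Let hedgehog_dist_pos x y : hedgehog_dist x y = 0 -> x = y.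
Proof.
rewrite /hedgehog_dist /predist => xy; apply: val_inj.
have [x0 y0] := (dep_ge0 x, dep_ge0 y).
have : `|pos (val x) - pos (val y)| = 0.
  move: xy; case: ifP => _; have := normr_ge0 (pos (val x) - pos (val y)).
    by have := normr_ge0 (dep (val x) - dep (val y)); lra.
  by lra.
(* On a common spike the depth determines the parameter, on the base the position does. With
   distinct labels both depths vanish, so both points lie on the base. *)
move: xy; case: eqP => [e1|ne] xy.
  move: xy; case: (val x) (val y) e1 => [ o t] [q s] /= <-.
  case: o => [i|] + /eqP; rewrite normr_eq0 subr_eq0 /pos /dep/=; last first.
    by rewrite !mulr1 => _ /eqP ->.
  move=> e /eqP ts; move: e; rewrite ts subrr normr0 add0r -mulrBl => /eqP.
  by rewrite normr_eq0 mulf_eq0 (gt_eqF (gt0 (w i))) orbF subr_eq0 => /eqP ->.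
move=> p0; move: xy; rewrite p0 => e0; have [/dep_eq0 x1 /dep_eq0 y1] :
  dep (val x) = 0 /\ dep (val y) = 0 by split; lra.
by rewrite x1 y1 in ne *.
Qed.

Let hedgehog_dist_triangle y x z :
  hedgehog_dist x z <= hedgehog_dist x y + hedgehog_dist y z.
Proof.
rewrite /hedgehog_dist /predist addrACA lerD ?ler_distD//.
have := (dep_ge0 x, dep_ge0 y, dep_ge0 z) => -[[]].
set a := dep (val x); set b := dep (val y); set c := dep (val z) => x0 y0 z0.
have [abc bca cab] : [/\ `|a - c| <= `|a - b| + `|b - c|,
    `|a - b| <= a + b /\ `|b - c| <= b + c & `|a - c| <= a + c].
  by rewrite ler_distD; split=> //; [split|]; rewrite ler_norml; lra.
(* For the mixed cases, where [y] shares the label of exactly one of [x] and [z]. *)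
have : a - b <= `|a - b| /\ c - b <= `|b - c|.
  by rewrite (distrC b); split; exact: ler_norm.
move: x0 y0 z0 abc bca cab; clear.
move: `|a - b| `|b - c| `|a - c| => u v w0 ? ? ? ? [? ?] ? [? ?].
case: eqP => [->|ne1]; case: eqP => [e2|ne2]; try case: eqP => e3; try lra.
by case: ne1; rewrite e2.
Qed.

HB.instance Definition _ := isMetric.Build R (hedgehog h w)
  hedgehog_distxx hedgehog_dist_pos hedgehog_dist_sym hedgehog_dist_triangle.

(* Truncating the parameter makes [spike] total and continuous on [R]. *)
Definition clip (t : R) : R := Num.max 0 (Num.min 1 t).

Lemma clip_itv t : 0 <= clip t <= 1.
Proof. by rewrite /clip le_max lexx ge_max ler01 ge_min lexx. Qed.

Lemma clip_id t : 0 <= t <= 1 -> clip t = t.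
Proof. by move=> /andP[t0 t1]; rewrite /clip min_r// max_r. Qed.

Lemma clip_dist s t : `|clip s - clip t| <= `|s - t|.
Proof.
have clipE u : [\/ u <= 0 /\ clip u = 0, 0 <= u <= 1 /\ clip u = u
    | 1 <= u /\ clip u = 1].
  have [u0|u0] := leP u 0.
    by constructor 1; split=> //; rewrite /clip min_r ?max_l//; lra.
  have [u1|u1] := leP u 1.
    by constructor 2; split; [lra|rewrite clip_id//; lra].
  by constructor 3; split; [lra|rewrite /clip min_l ?max_r//; lra].
wlog le_st : s t / s <= t => [hw|].
  by have [/hw//|/ltW/hw] := leP s t; rewrite distrC (distrC t).
rewrite distrC (distrC s) (ger0_norm (_ : 0 <= t - s)) ?subr_ge0// ler_norml.
by case: (clipE s) => -[? ->]; case: (clipE t) => -[? ->]; lra.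
Qed.

Lemma spike_subproof o t :
  spike_domain (if clip t == 0 then None else o, clip t).
Proof.
rewrite /spike_domain/= clip_itv/=; have [|ne] := eqVneq (clip t) 0;
  first by rewrite eqxx.
by rewrite lt_neqAle (eq_sym 0) ne; case/andP: (clip_itv t) => ->; rewrite orbT.
Qed.

Definition spike o t : hedgehog h w :=
  exist (@spike_domain R I) _ (spike_subproof o t).

(** At parameter 0 [spike] resets the label to [None], but each term that depends on that label has
    a factor 0 there, so no case distinction survives. *)
Lemma mdist_spikeE o t q s : mdist (spike o t) (spike q s) =
  `|clip t * spike_height o - clip s * spike_height q| +
  (if o == q then `|clip t - clip s| * spike_weight o
   else clip t * spike_weight o + clip s * spike_weight q).
Proof.
have tipE (F : option I -> R) u p :
  u * F (if u == 0 then None else p) = u * F p.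
  by case: eqP => // ->; rewrite !mul0r.
rewrite /mdist/= /hedgehog_dist /predist /pos /dep /= !tipE; congr (_ + _).
case/andP: (clip_itv t) => t0 _; case/andP: (clip_itv s) => s0 _.
have W := spike_weight_ge0.
have [->|tn] := eqVneq (clip t) 0; have [->|sn] := eqVneq (clip s) 0.
- by rewrite !mul0r subrr normr0 mul0r addr0 !if_same.
- rewrite !mul0r !add0r !normrN !ger0_norm ?mulr_ge0//.
  by rewrite if_same; case: eqP => [->|].
- rewrite !mul0r !addr0 ?subr0 !ger0_norm ?mulr_ge0//.
  by rewrite !if_same.
- case: eqP => // ->.
  by rewrite -mulrBl normrM (ger0_norm (W _)).
Qed.

Lemma spikeK x : spike (val x).1 (val x).2 = x.
Proof.
apply: val_inj; case: x => -[ o t] /= /andP[t01 /orP ot].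
rewrite clip_id//; congr (_, _); case: eqP => // t0.
by case: ot; rewrite ?t0 ?ltxx// => /eqP.
Qed.

Lemma spikeP x : exists o t, 0 <= t <= 1 /\ x = spike o t.
Proof.
exists (val x).1, (val x).2; rewrite spikeK; split=> //.
by case/andP: (valP x).
Qed.

End hedgehog_metric.

Lemma mdist_lipschitz_continuous (R : realType) (X Y : metricType R)
    (K : R) (f : X -> Y) :
  (forall x y, mdist (f x) (f y) <= K * mdist x y) -> continuous f.
Proof.
move=> fK x; apply/cvgrPdist_lt => e e0.
have K1 : 0 < `|K| + 1 by rewrite ltr_wpDl.
have /cvgrPdist_lt/(_ (e / (`|K| + 1))) : y @[y --> x] --> x by [].
move=> /(_ (divr_gt0 e0 K1)); apply: filterS => y /=.
rewrite ltr_pdivlMr// => xy; apply: le_lt_trans (fK _ _) (le_lt_trans _ xy).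
rewrite mulrC ler_wpM2l ?mdist_ge0//.
by have := ler_norm K; lra.
Qed.

(** * Connectedness and compactness of the hedgehog *)

Section hedgehog_topology.
Context {R : realType} {I : choiceType} (h : I -> R) (w : I -> {posnum R}).
Local Notation X := (hedgehog h w).
Local Notation height := (spike_height h).
Local Notation weight := (spike_weight w).
Implicit Types (o : option I) (x y : X).

Lemma mdist_spike_same o (t s : R) : mdist (spike h w o t) (spike h w o s) =
  (`|height o| + weight o) * `|clip t - clip s|.
Proof. by rewrite mdist_spikeE eqxx -mulrBl normrM; ring. Qed.

Lemma spike_continuous o : continuous (spike h w o).
Proof.
apply: (@mdist_lipschitz_continuous R R^o _ (`|height o| + weight o)) => t s.
rewrite mdist_spike_same ler_wpM2l ?addr_ge0 ?spike_weight_ge0//.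
by rewrite /mdist/= distrC; exact: clip_dist.
Qed.

Lemma spike0 o : spike h w o 0 = spike h w None 0.
Proof. by apply: val_inj; rewrite /= clip_id ?lexx ?ler01// eqxx. Qed.

Lemma hedgehog_connected : connected [set: X].
Proof.
(* A union of arcs through the common point at height 0. *)
rewrite (_ : setT = \bigcup_(o in [set: option I]) (spike h w o @` `[0, 1])).
  apply: bigcup_connected.
    exists (spike h w None 0) => o _; exists 0; last exact: spike0.
    by rewrite /= in_itv/= lexx ler01.
  move=> o _; apply: connected_continuous_connected.
    exact: segment_connected.
  by apply: continuous_subspaceT => t; exact: spike_continuous.
apply/seteqP; split=> // x _; have [ o [t [t01 ->]]] := spikeP x.
by exists o => //; exists t.
Qed.

Hypothesis h01 : forall i, 0 <= h i <= 1.
Hypothesis w_small : forall e : R, 0 < e ->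
  exists s : seq I, forall i, i \notin s -> (w i)%:num < e.

Lemma spike_height_itv o : 0 <= height o <= 1.
Proof. by case: o => [i|] /=; rewrite ?h01// ler01 lexx. Qed.

(* An ultrafilter that contains no spike leaves every finite set of spikes, so
   that the weight tends to 0 along it and it converges to a point of the base
   segment. *)
Lemma hedgehog_compact : compact [set: X].
Proof.
pose S o := spike h w o @` `[0, 1].
have cS o : compact (S o).
  apply: continuous_compact; last exact: segment_compact.
  by apply: continuous_subspaceT => t; exact: spike_continuous.
rewrite compact_ultra => F UF _.
have [ [ o FS]|noS] := pselect (exists o, F (S o)).
  have := cS o; rewrite compact_ultra => /(_ F UF FS)[x [_ Fx]].
  by exists x.
have {}noS o : F (~` S o).
  by have [Fo|//] := in_ultra_setVsetC (S o) UF; case: noS; exists o.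
pose pos x := (val x).2 * height (val x).1.
have pos01 x : 0 <= pos x <= 1.
  have [/andP[t0 t1] _] := andP (valP x).
  have /andP[a0 a1] := spike_height_itv (val x).1.
  by rewrite mulr_ge0//= mulr_ile1.
have [l [l01 Fl]] : `[0, 1]%classic `&` cluster (pos @ F) !=set0.
  apply: segment_compact.
  by apply: (@filterS _ F _ setT) => [x _|]; [rewrite /= in_itv/=|exact: filterT].
suff : cluster F (spike h w None l).
  by rewrite ultra_cvg_clusterE => Fx; exists (spike h w None l).
move=> A B FA; rewrite -filter_from_mdist_nbhs => -[e e0 eB].
(* Half of [e] is for the position, half for the depth; [s] contains every spike of weight at least
   [e / 2]. *)
have [s sP] := w_small (divr_gt0 e0 (ltr0Sn R 1)).
have Fs : \forall x \near F, forall i, i \in s -> ~ S (Some i) x.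
  elim: s {sP} => [|i s IH]; first by near=> x.
  near=> x => j; rewrite inE => /orP[/eqP ->|].
    by near: x; exact: noS.
  by move: j; near: x.
have FA' : (pos @ F) (pos @` [set x | [/\ A x, ~ S None x &
    forall i, i \in s -> ~ S (Some i) x]]).
  rewrite /fmap/=; near=> x; exists x => //; split; near: x => //; exact: noS.
have [_ [[x [Ax xN xs] <-]]] :=
  Fl _ _ FA' (nbhsx_ballx l _ (divr_gt0 e0 (ltr0Sn R 1))).
rewrite /ball/= => lx; exists x; split=> //; apply: eB => /=.
move: xN xs lx.
have [ o [t [t01 xE]]] := spikeP x.
have pxE : pos x = t * height o.
  rewrite xE /pos /= clip_id//.
  by case: eqP => // ->; rewrite !mul0r.
rewrite pxE xE mdist_spikeE !clip_id// mulr1 /=.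
case: o {pxE} xE => [i|] xE; last by move=> []; exists t.
move=> _ /(_ i) iS lt.
have : (w i)%:num < e / 2.
  by apply: sP; apply/negP => /iS; apply; exists t.
move: lt => /=; case/andP: t01 => t0 t1.
have : t * (w i)%:num <= (w i)%:num by rewrite ler_piMl.
by lra.
Unshelve. all: by end_near. Qed.

End hedgehog_topology.

(** * Maps permuting the spikes *)

Lemma iter_omap (T : Type) n (s : T -> T) x :
  iter n (omap s) (Some x) = Some (iter n s x).
Proof. by elim: n => //= n ->. Qed.

(** * Counting bounds for separated sets *)

Section sep_bounds.
Context {R : realType} {X : metricType R} (f : X -> X) (n : nat).

Lemma bowen_dist_le (x y : X) (e : R) : 0 <= e ->
  (forall k, (k < n)%N -> mdist (iter k f x) (iter k f y) <= e) ->
  bowen_dist f n x y <= e.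
Proof. by move=> e0 H; apply/bigmax_leP; split=> // i _; exact: H. Qed.

Lemma bowen_dist_ge (x y : X) k : (k < n)%N ->
  mdist (iter k f x) (iter k f y) <= bowen_dist f n x y.
Proof.
by move=> kn; apply: (le_bigmax _ (fun i : 'I_n => mdist (iter i f x) (iter i f y))
  (Ordinal kn)).
Qed.

(** Pigeonhole: a separated set meets each fibre of [g] at most once. *)
Lemma sep_le_card (T : finType) (g : X -> T) (e : R) :
  (forall x y, g x = g y -> bowen_dist f n x y < e) ->
  (sep f n e <= #|T|%:R%:E)%E.
Proof.
move=> ge; apply: ge_ereal_sup => _ [E sepE <-]; rewrite lee_fin ler_nat.
rewrite -(size_map g) cardE uniq_leq_size// => [|t _]; last by rewrite mem_enum.
rewrite map_inj_in_uniq ?fset_uniq// => x y xE yE gxy; apply/eqP/negPn/negP => xy.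
by have := sepE x y xE yE xy; rewrite leNgt ge.
Qed.

Lemma card_le_sep (T : finType) (g : T -> X) (e : R) : 0 < e ->
  (forall s t, s != t -> e <= bowen_dist f n (g s) (g t)) ->
  (#|T|%:R%:E <= sep f n e)%E.
Proof.
move=> e0 ge; apply: ereal_sup_ubound.
have gI : injective g.
  move=> s t gst; apply/eqP/negPn/negP => /ge; apply/negP; rewrite -ltNge.
  apply: le_lt_trans e0; apply: bowen_dist_le => // k _.
  by rewrite gst mdistxx.
exists (seq_fset tt (map g (enum T))).
  move=> x y; rewrite !seq_fsetE => /mapP[s _ ->] /mapP[t _ ->] gst.
  by apply: ge; apply: contraNneq gst => ->.
have gU : uniq (map g (enum T)) by rewrite map_inj_uniq ?enum_uniq.
by rewrite size_seq_fset undup_id// size_map -cardE.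
Qed.

Lemma sep_ge1 (x : X) (e : R) : 0 < e -> (1 <= sep f n e)%E.
Proof.
move=> e0; rewrite -[1%E]/(1%:R%:E) -card_unit.
by apply: (@card_le_sep unit (fun=> x)) => // -[] [].
Qed.

End sep_bounds.

(** * The map induced by a permutation of the spikes *)

Section hedgehog_map.
Context {R : realType} {I : choiceType} (h : I -> R) (w : I -> {posnum R}).
Local Notation X := (hedgehog h w).
Local Notation height := (spike_height h).
Local Notation weight := (spike_weight w).
Implicit Types (o : option I) (x y : X).

Definition hedgehog_map (s : I -> I) (x : X) : X :=
  spike h w (omap s (val x).1) (val x).2.

Lemma hedgehog_map_spike s o t :
  hedgehog_map s (spike h w o t) = spike h w (omap s o) t.
Proof.
apply: val_inj; rewrite /= clip_id ?clip_itv//.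
by case: eqP => // ->; rewrite eqxx.
Qed.

Lemma iter_hedgehog_map s k o t :
  iter k (hedgehog_map s) (spike h w o t) = spike h w (iter k (omap s) o) t.
Proof. by elim: k => //= k ->; exact: hedgehog_map_spike. Qed.

Lemma hedgehog_mapK s s' : cancel s s' ->
  cancel (hedgehog_map s) (hedgehog_map s').
Proof.
move=> sK x; have [ o [t [_ ->]]] := spikeP x.
by rewrite !hedgehog_map_spike omapK.
Qed.

Lemma hedgehog_map_pointwise_periodic s :
  pointwise_periodic s -> pointwise_periodic (hedgehog_map s).
Proof.
move=> sP x; have [ o [t [_ ->]]] := spikeP x.
case: o => [i|]; last by exists 1; rewrite //= hedgehog_map_spike.
have [n n0 ni] := sP i; exists n => //; rewrite iter_hedgehog_map.
by rewrite iter_omap ni.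
Qed.

Hypothesis h01 : forall i, 0 <= h i <= 1.
Variable s : I -> I.
Hypothesis s_inj : injective s.
Hypothesis w_s : forall i, w (s i) = w i.
Hypothesis h_s : forall i, `|h (s i) - h i| <= (w i)%:num.

Lemma weight_omap o : weight (omap s o) = weight o.
Proof. by case: o => //= i; rewrite w_s. Qed.

Lemma height_omap o : `|height (omap s o) - height o| <= weight o.
Proof. by case: o => [i|] /=; rewrite ?h_s// subrr normr0. Qed.

Lemma weight_iter_omap k o : weight (iter k (omap s) o) = weight o.
Proof. by elim: k => //= k; rewrite weight_omap. Qed.

Lemma height_iter_omap k o :
  `|height (iter k (omap s) o) - height o| <= k%:R * weight o.
Proof.
elim: k => [|k IH]; first by rewrite subrr normr0 mul0r.
rewrite iterS (le_trans (ler_distD (height (iter k (omap s) o)) _ _))//.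
rewrite -natr1 mulrDl mul1r addrC lerD//.
by rewrite (le_trans (height_omap _))// weight_iter_omap.
Qed.

(** A height moves by at most the weight, so the change in position is bounded by the depth part of
    the metric, which at most doubles. *)
Lemma hedgehog_map_lipschitz x y :
  mdist (hedgehog_map s x) (hedgehog_map s y) <= 2 * mdist x y.
Proof.
have [p [t [t01 ->]]] := spikeP x; have [q [u [u01 ->]]] := spikeP y.
rewrite !hedgehog_map_spike !mdist_spikeE !weight_omap !clip_id//.
have := (spike_weight_ge0 w p, spike_weight_ge0 w q) => -[wp wq].
have := (height_omap p, height_omap q).
have [/andP[t0 t1] /andP[u0 u1]] := (t01, u01).
have [pq|pq] := eqVneq p q.
  rewrite -pq eqxx -!mulrBl !normrM => -[hp _].
  have /andP[h0 h1] := spike_height_itv h01 p.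
  have /andP[h2 h3] := spike_height_itv h01 (omap s p).
  rewrite (ger0_norm h0) (ger0_norm h2).
  move: hp; rewrite ler_norml => /andP[_ hp].
  have : `|t - u| * height (omap s p) <= `|t - u| * (height p + weight p).
    by rewrite ler_wpM2l//; lra.
  have : 0 <= `|t - u| * height p by rewrite mulr_ge0.
  have : 0 <= `|t - u| * weight p by rewrite mulr_ge0.
  by lra.
rewrite (inj_eq (inj_omap s_inj)) (negbTE pq) => -[hp hq].
have tp : `|t * (height (omap s p) - height p)| <= t * weight p.
  by rewrite normrM (ger0_norm t0) ler_wpM2l.
have uq : `|u * (height (omap s q) - height q)| <= u * weight q.
  by rewrite normrM (ger0_norm u0) ler_wpM2l.
have -> : t * height (omap s p) - u * height (omap s q) =
    (t * height p - u * height q) + t * (height (omap s p) - height p) -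
    u * (height (omap s q) - height q) by ring.
have := ler_normB
  (t * height p - u * height q + t * (height (omap s p) - height p))
  (u * (height (omap s q) - height q)).
have := ler_normD (t * height p - u * height q)
  (t * (height (omap s p) - height p)).
have := normr_ge0 (t * height p - u * height q).
by lra.
Qed.

Lemma mdist_spike_le p t q u : 0 <= t <= 1 -> 0 <= u <= 1 ->
  mdist (spike h w p t) (spike h w q u) <=
  `|t * height p - u * height q| + weight p + weight q.
Proof.
move=> t01 u01; rewrite mdist_spikeE !clip_id// -addrA lerD2l.
have := (spike_weight_ge0 w p, spike_weight_ge0 w q) => -[wp wq].
have [/andP[t0 t1] /andP[u0 u1]] := (t01, u01).
have [_|_] := eqVneq p q.
  have tu1 : `|t - u| <= 1 by rewrite ler_norml; lra.
  by rewrite ler_wpDr// ler_piMl.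
by rewrite lerD// ler_piMl.
Qed.

(** * Three ways for two points to stay close up to time [n] *)

Section bowen_estimates.
Variable n : nat.
Local Notation dn := (bowen_dist (hedgehog_map s) n).

Lemma bowen_dist_same_spike p t u d : 0 <= t <= 1 -> 0 <= u <= 1 ->
  weight p <= 1 -> `|t - u| <= d ->
  dn (spike h w p t) (spike h w p u) <= 2 * d.
Proof.
move=> t01 u01 wp1 tu; apply: bowen_dist_le => [|k _].
  by have := normr_ge0 (t - u); lra.
rewrite !iter_hedgehog_map mdist_spike_same !clip_id// weight_iter_omap.
have /andP[h0 h1] := spike_height_itv h01 (iter k (omap s) p).
by rewrite ler_pM ?addr_ge0 ?spike_weight_ge0// ger0_norm//; lra.
Qed.

(** The two labels stay [b] steps apart on one orbit, so their heights differ by at most [b]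
    weights. The four [d] pay for the parameters, the heights and the two depths. *)
Lemma bowen_dist_same_orbit p b t u d : 0 <= t <= 1 -> 0 <= u <= 1 ->
  weight p <= d -> b%:R * weight p <= d -> `|t - u| <= d ->
  dn (spike h w p t) (spike h w (iter b (omap s) p) u) <= 4 * d.
Proof.
move=> t01 u01 wp bw tu; apply: bowen_dist_le => [|k _].
  by have := normr_ge0 (t - u); lra.
rewrite !iter_hedgehog_map -iterD addnC iterD.
apply: le_trans (mdist_spike_le _ _ t01 u01) _.
rewrite !weight_iter_omap; set q := iter k _ p.
have := height_iter_omap b q; rewrite weight_iter_omap.
have /andP[q0 q1] := spike_height_itv h01 q.
have [/andP[t0 t1] /andP[u0 u1]] := (t01, u01).
move=> hb.
have -> : t * height q - u * height (iter b (omap s) q) =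
  (t - u) * height q - u * (height (iter b (omap s) q) - height q) by ring.
have := ler_normB ((t - u) * height q) (u * (height (iter b (omap s) q) - height q)).
have : `|(t - u) * height q| <= d.
  by rewrite normrM (ger0_norm q0); apply: le_trans tu; rewrite ler_piMr.
have : `|u * (height (iter b (omap s) q) - height q)| <= d.
  rewrite normrM (ger0_norm u0); apply: le_trans bw; apply: le_trans hb.
  by rewrite ler_piMl.
by lra.
Qed.

(** In time [n] a height drifts by at most [n] weights. The five [d] pay for the initial positions,
    two drifts and two depths. *)
Lemma bowen_dist_slow p t q u d : 0 <= t <= 1 -> 0 <= u <= 1 -> (0 < n)%N ->
  n%:R * weight p <= d -> n%:R * weight q <= d ->
  `|t * height p - u * height q| <= d ->
  dn (spike h w p t) (spike h w q u) <= 5 * d.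
Proof.
move=> t01 u01 n0 np nq tu; apply: bowen_dist_le => [|k kn].
  by have := normr_ge0 (t * height p - u * height q); lra.
rewrite !iter_hedgehog_map.
apply: le_trans (mdist_spike_le _ _ t01 u01) _; rewrite !weight_iter_omap.
have := (spike_weight_ge0 w p, spike_weight_ge0 w q) => -[wp wq].
have [/andP[t0 t1] /andP[u0 u1]] := (t01, u01).
have n1 : (1 <= n%:R :> R) by rewrite ler1n.
have kn1 : (k%:R <= n%:R :> R) by rewrite ler_nat ltnW.
have slow o v : 0 <= v -> v <= 1 -> n%:R * weight o <= d -> weight o <= d /\
    `|v * (height (iter k (omap s) o) - height o)| <= d.
  move=> v0 v1 no; have wo := spike_weight_ge0 w o; split.
    by apply: le_trans no; rewrite ler_peMl.
  rewrite normrM (ger0_norm v0); apply: le_trans no.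
  apply: le_trans (_ : k%:R * weight o <= _); last by rewrite ler_wpM2r.
  apply: le_trans (height_iter_omap k o); by rewrite ler_piMl.
have [? tp] := slow p t t0 t1 np; have [? uq] := slow q u u0 u1 nq.
set P := height (iter k _ p) in tp *; set Q := height (iter k _ q) in uq *.
have -> : t * P - u * Q = (t * height p - u * height q) +
    t * (P - height p) - u * (Q - height q) by ring.
have := ler_normB (t * height p - u * height q + t * (P - height p))
  (u * (Q - height q)).
have := ler_normD (t * height p - u * height q) (t * (P - height p)).
by lra.
Qed.

End bowen_estimates.

End hedgehog_map.

(** * Spikes indexed by words *)

(* Position at time [j], in units of [2^-k], of a point that reads the word [c]:
   letter number [j %/ 2 ^ k.+1] is a tent of height [2 ^ k] if it is [true], and
   is flat otherwise. *)
Definition tooth (k : nat) (c : seq bool) (j : nat) : nat :=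
  (nth false c (j %/ 2 ^ k.+1) *
   minn (j %% 2 ^ k.+1) (2 ^ k.+1 - j %% 2 ^ k.+1))%N.

Lemma tooth_le k c j : (tooth k c j <= 2 ^ k)%N.
Proof.
rewrite /tooth expnS; case: nth; rewrite ?mul1n ?mul0n//.
by set m := (j %% _)%N; set p := (2 ^ k)%N; lia.
Qed.

(** A tent peaks in the middle of its time slot, so the position there reveals the letter. *)
Lemma tooth_mid k c i : tooth k c (i * 2 ^ k.+1 + 2 ^ k) = (nth false c i * 2 ^ k)%N.
Proof.
have k2 : (0 < 2 ^ k)%N by rewrite expn_gt0.
have kS : (2 ^ k < 2 ^ k.+1)%N by rewrite expnS; lia.
rewrite /tooth divnMDl ?expn_gt0// modnMDl divn_small// modn_small// addn0.
by congr muln; rewrite expnS; lia.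
Qed.

Lemma tooth_step k c r j : (j < 2 ^ k.+1 * r)%N ->
  (tooth k c (j.+1 %% (2 ^ k.+1 * r)) <= (tooth k c j).+1)%N /\
  (tooth k c j <= (tooth k c (j.+1 %% (2 ^ k.+1 * r))).+1)%N.
Proof.
move=> jr; have k2 : (0 < 2 ^ k)%N by rewrite expn_gt0.
have [dv|ndv] := boolP (2 ^ k.+1 %| j.+1)%N.
  (* The next phase starts a slot, possibly after wrapping around; teeth vanish there whatever the
     letter. *)
  have t0 : tooth k c (j.+1 %% (2 ^ k.+1 * r)) = 0%N.
    rewrite /tooth modn_dvdm ?dvdn_mulr// (eqP dv) min0n muln0//.
  rewrite t0; split=> //; rewrite /tooth.
  have jE : (j %% 2 ^ k.+1 = (2 ^ k.+1).-1)%N.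
    case/dvdnP: dv => -[//|q] qE.
    have -> : j = (q * 2 ^ k.+1 + (2 ^ k.+1).-1)%N.
      by move: qE; rewrite mulSn expnS; lia.
    by rewrite modnMDl modn_small// expnS; lia.
  rewrite jE; have k4 : (2 ^ k.+1 - (2 ^ k.+1).-1 = 1)%N by rewrite expnS; lia.
  rewrite k4 (leq_trans (_ : _ <= 1 * 1)%N)// leq_mul ?leq_b1//.
  by rewrite geq_minr.
have jr1 : (j.+1 < 2 ^ k.+1 * r)%N.
  rewrite ltn_neqAle jr andbT; apply: contraNneq ndv => ->.
  by rewrite dvdn_mulr.
rewrite (modn_small jr1) /tooth.
have L0 : (0 < 2 ^ k.+1)%N by rewrite expn_gt0.
have lt : ((j %% 2 ^ k.+1).+1 < 2 ^ k.+1)%N.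
  rewrite ltn_neqAle ltn_pmod// andbT; apply: contraNneq ndv => e.
  by rewrite {1}(divn_eq j (2 ^ k.+1)) -addnS e -mulSnr dvdn_mull.
have -> : (j.+1 %% 2 ^ k.+1 = (j %% 2 ^ k.+1).+1)%N.
  by rewrite {1}(divn_eq j (2 ^ k.+1)) -addnS modnMDl modn_small.
have -> : (j.+1 %/ 2 ^ k.+1 = j %/ 2 ^ k.+1)%N.
  by rewrite {1}(divn_eq j (2 ^ k.+1)) -addnS divnMDl// (divn_small lt) addn0.
case: nth; rewrite ?mul1n ?mul0n//; move: lt.
by set m := (j %% _)%N; set p := (2 ^ _)%N; lia.
Qed.

Section codes.
Context {R : realType} (r : nat -> nat).

(** The phases cover one full reading of the word; a scale with [r k = 0] has no spikes. *)
Definition code_index : Type :=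
  {k : nat & ((r k).-tuple bool * 'I_(2 ^ k.+1 * r k))%type}.
HB.instance Definition _ := Choice.on code_index.
Implicit Type i : code_index.

Definition code_shift i : code_index :=
  Tagged _ ((tagged i).1, ordS (tagged i).2).

Definition code_unshift i : code_index :=
  Tagged _ ((tagged i).1, ord_pred (tagged i).2).

Definition code_height i : R :=
  (tooth (tag i) (tagged i).1 (tagged i).2)%:R / 2 ^+ tag i.

(** One unit of [tooth] at that scale, hence a bound for the step of the height. *)
Definition code_weight i : {posnum R} := (2 ^- tag i)%:pos.

Lemma code_shiftK : cancel code_shift code_unshift.
Proof. by case=> k [c j]; rewrite /code_unshift/= ordSK. Qed.

Lemma code_unshiftK : cancel code_unshift code_shift.
Proof. by case=> k [c j]; rewrite /code_shift/= ord_predK. Qed.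

Lemma iter_code_shift m k c (j : 'I_(2 ^ k.+1 * r k)) :
  exists j' : 'I_(2 ^ k.+1 * r k), val j' = ((j + m) %% (2 ^ k.+1 * r k))%N /\
  iter m code_shift (existT _ k (c, j)) = existT _ k (c, j').
Proof.
elim: m => [|m [j' [jE IH]]]; first by exists j; rewrite addn0 modn_small.
exists (ordS j'); rewrite iterS IH /=; split=> //.
by rewrite jE -addn1 modnDml addn1 addnS.
Qed.

Lemma code_shift_pointwise_periodic : pointwise_periodic code_shift.
Proof.
case=> k [c j]; have N0 : (0 < 2 ^ k.+1 * r k)%N by case: j => j; case: muln.
exists (2 ^ k.+1 * r k)%N => //.
have [j' [jE ->]] := iter_code_shift (2 ^ k.+1 * r k) c j.
by congr existT; congr pair; apply: val_inj; rewrite /= jE modnDr modn_small.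
Qed.

Lemma code_height_itv i : 0 <= code_height i <= 1.
Proof.
rewrite /code_height divr_ge0//= ler_pdivrMr ?exprn_gt0// mul1r -natrX ler_nat.
exact: tooth_le.
Qed.

Lemma code_height_shift i :
  `|code_height (code_shift i) - code_height i| <= (code_weight i)%:num.
Proof.
case: i => k [c j]; rewrite /code_height /code_weight/= -mulrBl normrM.
rewrite (ger0_norm (_ : 0 <= 2 ^- k)) ?invr_ge0 ?exprn_ge0//.
rewrite ler_piMl ?invr_ge0 ?exprn_ge0//.
have [] := tooth_step c (ltn_ord j).
by rewrite ler_norml -2!(ler_nat R) -!natr1; lra.
Qed.

Lemma code_weight_small (e : R) : 0 < e ->
  exists s : seq code_index, forall i, i \notin s -> (code_weight i)%:num < e.
Proof.
(* Each scale has finitely many spikes, and for [k >= M] one has [2 ^ k > k >= M > 1 / e]. *)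
move=> e0; pose M := (Num.truncn e^-1).+1.
pose F (k : nat) : seq code_index :=
  [seq existT _ k x | x <- enum {: (r k).-tuple bool * 'I_(2 ^ k.+1 * r k)}].
exists (flatten [seq F k | k <- iota 0 M]) => -[k x] ks.
have {ks} Mk : (M <= k)%N.
  rewrite leqNgt; apply: contra ks => kM; apply/flatten_mapP.
  by exists k; rewrite ?mem_iota//; apply: map_f; rewrite mem_enum.
rewrite /code_weight/= invf_plt ?posrE ?exprn_gt0//.
apply: lt_le_trans (Num.Theory.truncnS_gt e^-1) _.
by rewrite -natrX ler_nat (leq_trans Mk)// ltnW// ltn_expl.
Qed.

Definition code_space := hedgehog code_height code_weight.
Definition code_map : code_space -> code_space := hedgehog_map code_shift.

End codes.

Lemma bowen_dist_sym (R : realType) (X : metricType R) (f : X -> X) n x y :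
  bowen_dist f n x y = bowen_dist f n y x.
Proof. by apply: eq_bigr => i _; rewrite metric_sym. Qed.

(** [inord] sends all out-of-range values to 0, whence the two bounds. *)
Lemma inord_eq n a b : (a <= n)%N -> (b <= n)%N ->
  inord a = inord b :> 'I_n.+1 -> a = b.
Proof. by move=> an bn /(congr1 val); rewrite /= !inordK. Qed.

Lemma truncn_scaled_le (R : realType) (M : nat) (t : R) : t <= 1 ->
  (Num.truncn (t * M%:R) <= M)%N.
Proof.
move=> t1; rewrite truncn_le_nat -natr1.
have : t * M%:R <= M%:R by rewrite ler_piMl.
by lra.
Qed.

Lemma truncn_scaled_eq (R : realType) (M : nat) (t u : R) : (0 < M)%N ->
  0 <= t -> 0 <= u ->
  Num.truncn (t * M%:R) = Num.truncn (u * M%:R) -> `|t - u| <= M%:R^-1.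
Proof.
move=> M0 t0 u0 e; have M1 : 0 < M%:R :> R by rewrite ltr0n.
rewrite -[leRHS]mul1r ler_pdivlMr// -[X in _ * X](gtr0_norm M1) -normrM mulrBl.
have /truncn_itv/andP[] : 0 <= t * M%:R by rewrite mulr_ge0.
have /truncn_itv/andP[] : 0 <= u * M%:R by rewrite mulr_ge0.
by rewrite e -natr1 ler_norml; lra.
Qed.

(** * Lower and upper bounds for [sep] of the code map *)

Section code_entropy.
Context {R : realType} (r : nat -> nat).
Local Notation f := (@code_map R r).
Local Notation spk := (spike (@code_height R r) (@code_weight R r)).

Lemma code_sep_ge n k (e : R) : 0 < e -> e <= 1 -> (2 ^ k.+1 * r k <= n)%N ->
  ((2 ^ r k)%:R%:E <= sep f n e)%E.
Proof.
(* If [r k = 0] there is no phase to start from, but then a single point is enough. *)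
move=> e0 e1 kn; have [N0|] := ltnP 0 (2 ^ k.+1 * r k); last first.
  rewrite leqn0 muln_eq0 expn_eq0/= => /eqP ->; rewrite expn0.
  by apply: sep_ge1 => //; exact: spk None 0.
pose g (c : (r k).-tuple bool) := spk (Some (existT _ k (c, Ordinal N0))) 1.
have -> : (2 ^ r k = #|{: (r k).-tuple bool}|)%N by rewrite card_tuple card_bool.
apply: (@card_le_sep _ _ _ _ _ g) => // c c' cc'; apply: le_trans e1 _.
have [i ii] : exists i : 'I_(r k), tnth c i != tnth c' i.
  apply/existsP; rewrite -negb_forall; apply: contra cc' => /forallP H.
  by apply/eqP/eq_from_tnth => i; exact/eqP/H.
(* Starting at the tips with phase 0, this is the middle of the slot of a letter where the words
   differ: one height is 1, the other 0. *)
pose m := (i * 2 ^ k.+1 + 2 ^ k)%N.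
have mN : (m < 2 ^ k.+1 * r k)%N.
  have := ltn_ord i; rewrite /m expnS; have : (0 < 2 ^ k)%N by rewrite expn_gt0.
  by nia.
apply: le_trans (bowen_dist_ge _ _ _ (leq_trans mN kn)).
have gE d : iter m f (g d) =
    spk (Some (existT _ k (d, Ordinal mN))) 1.
  rewrite iter_hedgehog_map; congr spike.
  have [j [jE mE]] := iter_code_shift m d (Ordinal N0).
  have -> : Ordinal mN = j by apply: val_inj; rewrite jE /= add0n modn_small.
  by rewrite iter_omap mE.
rewrite !gE mdist_spikeE !clip_id ?ler01 ?lexx// !mul1r.
apply: ler_wpDr.
  case: ifP => _; rewrite ?addr_ge0 ?mulr_ge0 ?spike_weight_ge0//.
rewrite /= /code_height/= !tooth_mid -!tnth_nth -mulrBl.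
rewrite !natrM natrX -mulrBl mulfK ?expf_neq0//.
by move: (tnth c i) (tnth c' i) ii => [] [] //= _;
  rewrite ?subr0 ?sub0r ?normrN normr1.
Qed.

Hypothesis r_homo : {homo r : k l / (k <= l)%N}.

(** Within a block of [2 ^ k %/ M] phases the height varies by at most [1 / M]; for [2 ^ k < M]
    blocks are single phases. The constant 5 exceeds the 2 and 4 of the two estimates used and is
    the one of the slow case. *)
Lemma code_same_orbit M n k (c : (r k).-tuple bool)
    (j j' : 'I_(2 ^ k.+1 * r k)) (t u : R) : (0 < M)%N ->
  0 <= t <= 1 -> 0 <= u <= 1 -> `|t - u| <= M%:R^-1 ->
  (j %/ maxn 1 (2 ^ k %/ M) = j' %/ maxn 1 (2 ^ k %/ M))%N ->
  bowen_dist f n (spk (Some (existT _ k (c, j))) t)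
                 (spk (Some (existT _ k (c, j'))) u) <= 5 / M%:R.
Proof.
move=> M0 t01 u01 tu; have M1 : 0 < M%:R :> R by rewrite ltr0n.
wlog jj' : j j' t u t01 u01 tu / (j <= j')%N => [hw|].
  have [/hw|/ltnW j'j jE] := leqP j j'; first exact.
  by rewrite bowen_dist_sym hw// distrC.
set B := maxn 1 _ => jB; have B0 : (0 < B)%N by rewrite leq_max.
have jlt : (j' - j < B)%N.
  rewrite (divn_eq j B) (divn_eq j' B) jB subnDl.
  by rewrite (leq_ltn_trans (leq_subr _ _))// ltn_pmod.
have Mi : 0 <= M%:R^-1 :> R by rewrite invr_ge0 ltW.
have h01 := @code_height_itv R r.
have w_s i : @code_weight R r (code_shift i) = code_weight i by [].
have [b0|b0] := posnP (j' - j)%N.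
  have -> : j' = j.
    by apply/val_inj/eqP; rewrite eqn_leq jj' -subn_eq0 b0.
  apply: le_trans (bowen_dist_same_spike h01 w_s _ t01 u01 _ tu) _.
    by rewrite /code_weight/= invf_le1 ?exprn_gt0// exprn_ege1// ler1n.
  by lra.
have -> : Some (existT _ k (c, j')) =
    iter (j' - j)%N (omap (@code_shift r)) (Some (existT _ k (c, j))).
  have [l [lE mE]] := iter_code_shift (j' - j)%N c j.
  have jl : j' = l by apply: val_inj; rewrite lE subnKC// modn_small.
  by rewrite iter_omap mE -jl.
(* Two distinct phases in one block force its length above 1. *)
have BE : (B = 2 ^ k %/ M)%N.
  apply/maxn_idPr; move: (leq_ltn_trans b0 jlt).
  by rewrite /B leq_max ltnn => /ltnW.
have bM : ((j' - j) * M <= 2 ^ k)%N.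
  rewrite (leq_trans _ (leq_trunc_div (2 ^ k) M))// -BE leq_mul//.
  exact: ltnW.
have Mk : (M <= 2 ^ k)%N by rewrite (leq_trans _ bM)// leq_pmull.
apply: le_trans (bowen_dist_same_orbit h01 w_s (@code_height_shift R r) _
  t01 u01 _ _ tu) _.
- by rewrite /= lef_pV2 ?posrE ?exprn_gt0// -natrX ler_nat.
- rewrite /= ler_pdivrMr ?exprn_gt0// mulrC ler_pdivlMr//.
  by rewrite -natrM -natrX ler_nat.
- by lra.
Qed.

(* The number of [(n, e)]-indistinguishability classes: at most [M.+1] heights
   [t], and either a slow spike or a scale [<= K], a word and a block of phases. *)
Definition code_bound M K : nat :=
  ((K.+1 * 2 ^ r K * (4 * M * r K).+1).+1 * M.+1)%N.

(** A spike with [2 ^ k >= n * M] drifts by at most [1 / M] in time [n], so its position alone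
    classifies the point. The other scales are at most [K]. *)
Lemma code_sep_le M n (e : R) : (0 < M)%N -> (0 < n)%N -> 5 / M%:R < e ->
  (sep f n e <= (code_bound M (trunc_log 2 (n * M)))%:R%:E)%E.
Proof.
set K := trunc_log _ _; rewrite /code_bound => M0 n0 Me.
have M1 : 0 < M%:R :> R by rewrite ltr0n.
pose T := (option ('I_K.+1 * (r K).-tuple bool * 'I_(4 * M * r K).+1) * 'I_M.+1)%type.
pose gN (o : option (code_index r)) (t : R) : T :=
  (None, inord (Num.truncn (t * spike_height (@code_height R r) o * M%:R))).
(* Words are padded with [false] to the common length [r K], and [t] is recorded up to [1 / M]. *)
pose g (o : option (code_index r)) (t : R) : T := if o is Some i then
  if (2 ^ tag i < n * M)%N then
    (Some (inord (tag i), [tuple nth false (tagged i).1 l | l < r K],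
      inord ((tagged i).2 %/ maxn 1 (2 ^ tag i %/ M))%N),
     inord (Num.truncn (t * M%:R)))
  else gN o t else gN o t.
have -> : ((K.+1 * 2 ^ r K * (4 * M * r K).+1).+1 * M.+1 = #|{: T}|)%N.
  by rewrite card_prod card_option !card_prod !card_ord card_tuple card_bool.
apply: (@sep_le_card R (@code_space R r) f n T
  (fun x : code_space r => g (val x).1 (val x).2) e) => x y.
rewrite -[in bowen_dist _ _ _ _](spikeK x) -[in bowen_dist _ _ _ _](spikeK y).
have x01 : 0 <= (val x).2 <= 1 by case/andP: (valP x).
have y01 : 0 <= (val y).2 <= 1 by case/andP: (valP y).
move: (val x).1 (val x).2 x01 (val y).1 (val y).2 y01 => o t t01 q u u01.
pose fast (o : option (code_index r)) :=
  if o is Some i then (2 ^ tag i < n * M)%N else false.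
have gslow p v : ~~ fast p -> g p v = gN p v by case: p => //= i /negbTE ->.
have slow_weight p : ~~ fast p -> n%:R * spike_weight (@code_weight R r) p <= M%:R^-1.
  case: p => [i|] /=; last by rewrite mulr0 invr_ge0 ltW.
  rewrite -leqNgt => nM; rewrite ler_pdivrMr ?exprn_gt0// mulrC ler_pdivlMr//.
  by rewrite -natrM -natrX ler_nat.
have h01 := @code_height_itv R r.
have [/andP[t0 t1] /andP[u0 u1]] := (t01, u01).
have [fo|fo] := boolP (fast o); have [fq|fq] := boolP (fast q); last first.
- rewrite !gslow// => -[] gN_eq; apply: le_lt_trans Me.
  have w_s i : @code_weight R r (code_shift i) = code_weight i by [].
  apply: (bowen_dist_slow w_s (@code_height_shift R r) t01 u01 n0
    (slow_weight _ fo) (slow_weight _ fq)).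
  have /andP[ho0 ho1] := spike_height_itv h01 o.
  have /andP[hq0 hq1] := spike_height_itv h01 q.
  apply: truncn_scaled_eq; rewrite ?mulr_ge0//.
  by apply: inord_eq gN_eq; rewrite truncn_scaled_le// mulr_ile1.
- by case: q fq {u01} => // i /=; rewrite (gslow o)// => ->.
- by case: o fo {t01} => // i /=; rewrite (gslow q)// => ->.
case: o fo => // -[k [c j]] /= kn; case: q fq => // -[k' [c' j']] /= k'n.
rewrite kn k'n => -[].
have kK : (k <= K)%N by rewrite trunc_log_max// ltnW.
have k'K : (k' <= K)%N by rewrite trunc_log_max// ltnW.
move=> /(inord_eq kK k'K) kk'; subst k'.
(* With block length [B], rounding gives [2 ^ k <= 2 * M * B]; the other factor 2 comes from
   [2 ^ k.+1]. *)
have blk (l : 'I_(2 ^ k.+1 * r k)) : (l %/ maxn 1 (2 ^ k %/ M) <= 4 * M * r K)%N.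
  rewrite (leq_trans (leq_div2r _ (ltnW (ltn_ord l))))//.
  set B := maxn _ _; have B0 : (0 < B)%N by rewrite leq_max.
  rewrite -ltnS ltn_divLR//.
  have k2 : (2 ^ k < M * (2 ^ k %/ M).+1)%N by rewrite mulnC -ltn_divLR.
  have := r_homo kK; have : (2 ^ k %/ M < B.+1)%N by rewrite ltnS leq_maxr.
  rewrite expnS; move: (2 ^ k)%N (2 ^ k %/ M)%N k2 => p z pz zB rr.
  have : (p <= 2 * M * B)%N by nia.
  move=> pB; apply: (@leq_ltn_trans (2 * (2 * M * B) * r K)); last by nia.
  by rewrite leq_mul// leq_mul.
move=> cc' /(inord_eq (blk j) (blk j')) jj' /inord_eq tu.
have {}tu : `|t - u| <= M%:R^-1.
  by apply: truncn_scaled_eq => //; apply: tu; rewrite truncn_scaled_le.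
(* Since [r] is monotone, [r k <= r K] and padding loses no letter. *)
have ce : c = c'.
  apply/eq_from_tnth => i.
  have iK : (i < r K)%N by rewrite (leq_trans (ltn_ord i))// r_homo.
  move: (congr1 (nth false ^~ i) cc').
  rewrite !(nth_map (Ordinal iK)) -?enumT ?size_enum_ord// nth_enum_ord//.
  by rewrite !(tnth_nth false).
by rewrite -ce; apply: le_lt_trans Me; exact: code_same_orbit.
Qed.

End code_entropy.

(** * Growth rates *)

Section limsup.
Context {R : realType}.
Implicit Types (u : nat -> \bar R) (b l : \bar R).

Lemma limn_esup_le u b :
  (exists N, forall n, (N <= n)%N -> (u n <= b)%E) -> (limn_esup u <= b)%E.
Proof.
move=> [N uN]; apply: ge_ereal_inf.
exists (ereal_sup (u @` [set n | (N <= n)%N])).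
  by exists [set n | (N <= n)%N] => //; exists N.
by apply: ge_ereal_sup => _ [n /= Nn <-]; exact: uN.
Qed.

Lemma limn_esup_ge u l :
  (forall N, exists2 n, (N <= n)%N & (l <= u n)%E) -> (l <= limn_esup u)%E.
Proof.
move=> ul; apply: le_ereal_inf_tmp => _ [V [N _ NV] <-].
have [n Nn ln] := ul N; apply: le_trans ln _.
by apply: ereal_sup_ubound; exists n => //; exact: NV.
Qed.

Lemma lne_div_ln_le (S : \bar R) (c n : nat) : (1 < n)%N -> (0 < c)%N ->
  (0 <= S <= c%:R%:E)%E ->
  (lne S / (ln n%:R)%:E <= (ln c%:R / ln n%:R)%:E)%E.
Proof.
move=> n1 c0 /andP[S0 Sc].
have ln0 : 0 < ln n%:R :> R by rewrite ln_gt0// ltr1n.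
have c1 : 0 < c%:R :> R by rewrite ltr0n.
rewrite inver gt_eqF// EFinM; apply: lee_wpmul2r.
  by rewrite lee_fin invr_ge0 ltW.
by rewrite -(lne_EFin c1) lee_lne// in_itv/= ?S0 ?leey// lee_fin ltW.
Qed.

Lemma lne_div_ln_ge (S : \bar R) (c n : nat) : (1 < n)%N -> (0 < c)%N ->
  (c%:R%:E <= S)%E ->
  ((ln c%:R / ln n%:R)%:E <= lne S / (ln n%:R)%:E)%E.
Proof.
move=> n1 c0 Sc.
have ln0 : 0 < ln n%:R :> R by rewrite ln_gt0// ltr1n.
have c1 : 0 < c%:R :> R by rewrite ltr0n.
rewrite inver gt_eqF// EFinM; apply: lee_wpmul2r.
  by rewrite lee_fin invr_ge0 ltW.
have c0E : (0 <= c%:R%:E :> \bar R)%E by rewrite lee_fin ltW.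
rewrite -(lne_EFin c1) lee_lne//; rewrite in_itv/= leey andbT//.
exact: le_trans Sc.
Qed.

End limsup.

(** * Growth rate of [sep] for the code map *)

Section code_asymptotics.
Context {R : realType} (r : nat -> nat).
Local Notation f := (@code_map R r).
Local Notation rate e :=
  (limn_esup (fun n : nat => lne (sep f n e) / (ln n%:R)%:E)%E).

(** At time [2 ^ m] the [2 ^ r k] separated words contribute the quotient [r k / m]. *)
Lemma code_rate_ge (b e : R) : 0 < e -> e <= 1 ->
  (forall N, exists2 m, (N <= m)%N &
    exists2 k, (2 ^ k.+1 * r k <= 2 ^ m)%N & b * m%:R <= (r k)%:R) ->
  (b%:E <= rate e)%E.
Proof.
move=> e0 e1 H; apply: limn_esup_ge => N.
(* [N.+1] makes [m] positive, so that [ln (2 ^ m)] is nonzero. *)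
have [m Nm [k km bm]] := H N.+1.
have m0 : (0 < m)%N by exact: leq_trans Nm.
exists (2 ^ m)%N; first by rewrite ltnW// (leq_ltn_trans _ (ltn_expl m _))// ltnW.
have l2 : 0 < ln 2 :> R by rewrite ln_gt0// ltr1n.
apply: le_trans (lne_div_ln_ge _ _ (code_sep_ge e0 e1 km)); last 2 first.
- by rewrite -(expn0 2) ltn_exp2l.
- by rewrite expn_gt0.
rewrite lee_fin !natrX !lnXn// -!(mulr_natl (ln 2)) invfM.
rewrite mulrACA mulfV ?gt_eqF// mulr1 ler_pdivlMr ?ltr0n//.
Qed.

Hypothesis r_homo : {homo r : k l / (k <= l)%N}.

(** Since [2 ^ K <= n * M], the words contribute at most [a * (ln n + ln M)]; the remaining factor,
    quadratic in [K], is absorbed by [eta]. *)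
Lemma ln_code_bound_le (a eta : R) (M : nat) : 0 <= a -> 0 < eta -> (0 < M)%N ->
  (forall k, (r k)%:R <= a * k%:R) ->
  exists D : R, forall n, (0 < n)%N ->
    ln (code_bound r M (trunc_log 2 (n * M)))%:R <= D + (a + eta) * ln n%:R.
Proof.
move=> a0 eta0 M0 ra.
have l2 : 0 < ln 2 :> R by rewrite ln_gt0// ltr1n.
(* Chosen so that twice the bound [ln K.+1 <= d * K.+1 - ln d] costs [eta * K * ln 2] and a
   constant. *)
pose d : R := eta * ln 2 / 2; have d0 : 0 < d by rewrite divr_gt0// mulr_gt0.
pose A : R := M.+1%:R * (4 * M%:R * a + 2).
have A0 : 0 < A by rewrite mulr_gt0 ?ltr0n// ltr_wpDl// !mulr_ge0.
exists (ln A + 2 * (d - ln d) + (a + eta) * ln M%:R) => n n0.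
have nM0 : (0 < n * M)%N by rewrite muln_gt0 n0.
set K := trunc_log 2 _.
have K2 : K%:R * ln 2 <= ln n%:R + ln M%:R :> R.
  rewrite -lnM ?posrE ?ltr0n// -natrM mulr_natl -lnXn// -natrX.
  by rewrite ler_ln ?posrE ?ltr0n ?expn_gt0// ler_nat trunc_logP.
have lnK : ln K.+1%:R <= d * K.+1%:R - ln d.
  have : ln (d * K.+1%:R) <= d * K.+1%:R.
    by rewrite ltW// ln_sublinear// mulr_gt0// ltr0n.
  by rewrite lnM ?posrE ?ltr0n//; lra.
have rK := ra K.
have bound : (code_bound r M K)%:R <= A * K.+1%:R ^+ 2 * 2 ^+ r K.
  rewrite /code_bound natrM -natr1 !natrM natrX -[(4 * M * r K).+1%:R]natr1 !natrM.
  set p := 2 ^+ r K; have p1 : 1 <= p by rewrite exprn_ege1// ler1n.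
  have -> : A * K.+1%:R ^+ 2 * p =
    K.+1%:R * p * ((4 * M%:R * a + 2) * K.+1%:R) * M.+1%:R by rewrite /A; ring.
  rewrite ler_wpM2r//.
  (* This lets the outer successor in [code_bound] be absorbed into the last factor, turning its
     [+ 1] into the [+ 2] of [A]. *)
  have Kp : 1 <= K.+1%:R * p by rewrite mulr_ege1// ler1n.
  have : 4 * M%:R * (r K)%:R + 2 <= (4 * M%:R * a + 2) * K.+1%:R.
    rewrite -natr1; have : 4 * M%:R * (r K)%:R <= 4 * M%:R * (a * K%:R).
      by rewrite ler_wpM2l// mulr_ge0.
    have : 0 <= M%:R * a by rewrite mulr_ge0.
    have : 0 <= K%:R :> R by [].
    by lra.
  move=> /(ler_wpM2l (ltW (lt_le_trans ltr01 Kp))); lra.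
have /(le_trans _) : ln (A * K.+1%:R ^+ 2 * 2 ^+ r K) <=
    ln A + 2 * (d - ln d) + (a + eta) * ln M%:R + (a + eta) * ln n%:R.
  have -> : ln (A * K.+1%:R ^+ 2 * 2 ^+ r K) =
      ln A + 2 * ln K.+1%:R + (r K)%:R * ln 2.
    rewrite (@lnM _ (A * _)) ?posrE ?exprn_gt0//; last first.
      by rewrite mulr_gt0// exprn_gt0// ltr0n.
    rewrite (@lnM _ A) ?posrE ?exprn_gt0 ?ltr0n// !lnXn ?ltr0n//.
    by rewrite (mulr_natl (ln 2)) (mulr_natl (ln _)).
  have : (r K)%:R * ln 2 <= a * K%:R * ln 2 by rewrite ler_wpM2r// ltW.
  have : a * (K%:R * ln 2) <= a * (ln n%:R + ln M%:R) by rewrite ler_wpM2l.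
  have : eta * (K%:R * ln 2) <= eta * (ln n%:R + ln M%:R) by rewrite ler_wpM2l// ltW.
  move: lnK; rewrite -[in d * _]natr1 /d; lra.
apply; have c0 : 0 < (code_bound r M K)%:R :> R by rewrite ltr0n /code_bound.
by rewrite ler_ln ?posrE//; exact: lt_le_trans bound.
Qed.

Lemma code_rate_le (a e : R) : 0 <= a -> 0 < e ->
  (forall k, (r k)%:R <= a * k%:R) -> (rate e <= a%:E)%E.
Proof.
move=> a0 e0 ra; apply/lee_addgt0Pr => eta eta0.
pose M := (Num.truncn (5 / e)).+1.
have Me : 5 / M%:R < e.
  by rewrite ltr_pdivrMr ?ltr0n// mulrC -ltr_pdivrMr// truncnS_gt.
have [D HD] := @ln_code_bound_le a (eta / 2) M
  a0 (divr_gt0 eta0 (ltr0Sn R 1)) isT ra.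
(* From here on the constant [D] is at most [eta / 2 * ln n], the other half of [eta]; [.+2] also
   gives [n > 1]. *)
apply: limn_esup_le; exists (Num.truncn (expR (2 * D / eta))).+2 => n Nn.
have n1 : (1 < n)%N by exact: leq_trans Nn.
have n0 : (0 < n)%N by exact: ltnW.
have ln0 : 0 < ln n%:R :> R by rewrite ln_gt0// ltr1n.
have Dn : 2 * D / eta <= ln n%:R.
  rewrite -ler_expR lnK ?posrE ?ltr0n//; apply/ltW.
  by apply: lt_le_trans (truncnS_gt _) _; rewrite ler_nat ltnW.
have sep_bound : (0 <= sep f n e <=
    (code_bound r M (trunc_log 2 (n * M)))%:R%:E)%E.
  rewrite code_sep_le// andbT (le_trans _ (sep_ge1 _ _ _ e0))//.
  exact: spike None 0.
apply: le_trans (lne_div_ln_le n1 _ sep_bound) _; first by rewrite /code_bound.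
rewrite lee_fin ler_pdivrMr//; apply: le_trans (HD n n0) _.
by move: Dn; rewrite ler_pdivrMr//; lra.
Qed.

End code_asymptotics.

(** * The homeomorphism, the word lengths and the conclusion *)

Lemma hedgehog_map_homeomorphism (R : realType) (I : choiceType) (h : I -> R)
    (w : I -> {posnum R}) (s s' : I -> I) :
  (forall i, 0 <= h i <= 1) -> cancel s s' -> cancel s' s ->
  (forall i, w (s i) = w i) -> (forall i, `|h (s i) - h i| <= (w i)%:num) ->
  homeomorphism (@hedgehog_map R I h w s).
Proof.
move=> h01 sK s'K ws hs; exists (hedgehog_map s').
(* The inverse permutation satisfies the same hypotheses, so both maps are Lipschitz. *)
have ws' i : w (s' i) = w i by rewrite -{2}(s'K i) ws.
have hs' i : `|h (s' i) - h i| <= (w i)%:num.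
  by rewrite -{2}(s'K i) distrC -(ws' i) hs.
split; [exact: hedgehog_mapK|exact: hedgehog_mapK| |];
  apply: mdist_lipschitz_continuous; apply: hedgehog_map_lipschitz => //.
- exact: can_inj sK.
- exact: can_inj s'K.
Qed.

Lemma pol_entropyE (R : realType) (X : metricType R) (f : X -> X) (a : \bar R) :
  (forall e : R, 0 < e -> e <= 1 ->
    limn_esup (fun n : nat => lne (sep f n e) / (ln n%:R)%:E)%E = a) ->
  pol_entropy f = a.
Proof.
move=> fa; apply: lim_near_cst => //; near=> e; apply: fa.
  by near: e; exact: nbhs_right_gt.
by near: e; exact: nbhs_right_le.
Unshelve. all: by end_near. Qed.

(** Equality holds at 16; beyond, doubling outgrows the step of the fourth power. *)
Lemma exp4_le_exp2 i : (16 <= i)%N -> (i ^ 4 <= 2 ^ i)%N.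
Proof.
move=> i16; rewrite -(subnK i16); elim: (i - 16)%N => [//|n IH].
rewrite addSn (expnS 2); apply: leq_trans (leq_mul (leqnn 2) IH).
have : (16 <= n + 16)%N by rewrite leq_addl.
by move: (n + 16)%N => m; rewrite !expnS expn0; nia.
Qed.

(* The witness is the scale k = i^2, observed at time 2^(i^2 + 1 + i). *)
Lemma code_rate_ge_squares (R : realType) (r : nat -> nat) (b e : R) :
  0 < e -> e <= 1 ->
  (exists i0, forall i, (i0 <= i)%N ->
    (r (i ^ 2) <= 2 ^ i)%N /\ b * (i ^ 2 + 1 + i)%N%:R <= (r (i ^ 2)%N)%:R) ->
  (b%:E <= limn_esup (fun n : nat =>
     lne (sep (@code_map R r) n e) / (ln n%:R)%:E))%E.
Proof.
move=> e0 e1 [i0 ri]; apply: code_rate_ge => // N.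
pose i := maxn N i0; have [r2 br] := ri i (leq_maxr _ _).
exists (i ^ 2 + 1 + i)%N.
  by rewrite (leq_trans (leq_maxl N i0))// leq_addl.
by exists (i ^ 2)%N => //; rewrite expnD addn1 leq_mul.
Qed.

Lemma code_rate_infinite (R : realType) (e : R) : 0 < e -> e <= 1 ->
  limn_esup (fun n : nat =>
    lne (sep (@code_map R (fun k => k ^ 2)%N) n e) / (ln n%:R)%:E)%E = +oo%E.
Proof.
move=> e0 e1; apply/eqyP => b b0; apply: code_rate_ge_squares => //.
(* The 3 comes from [i ^ 2 + 1 + i <= 3 * i ^ 2], against [r (i ^ 2) = i ^ 4]. *)
exists (maxn 16 (Num.truncn (3 * b)).+1) => i; rewrite geq_max => /andP[i16 bi].
rewrite -expnM; split; first exact: exp4_le_exp2.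
have b3 : 3 * b <= i%:R.
  by rewrite ltW// (lt_le_trans (truncnS_gt _))// ler_nat.
apply: le_trans (_ : b * (3 * i ^ 2)%N%:R <= _).
  by rewrite ler_pM2l// ler_nat; nia.
apply: le_trans (_ : i%:R * (i ^ 2)%N%:R <= _).
  by rewrite natrM mulrA (mulrC b) ler_wpM2r.
by rewrite -natrM ler_nat -expnS leq_exp2l//; lia.
Qed.

Lemma code_rate_finite (R : realType) (a e : R) : 0 <= a -> 0 < e -> e <= 1 ->
  limn_esup (fun n : nat => lne (sep (@code_map R
    (fun k => Num.truncn (a * k%:R))) n e) / (ln n%:R)%:E)%E = a%:E.
Proof.
move=> a0 e0 e1; apply/eqP; rewrite eq_le; apply/andP; split.
  apply: code_rate_le => // [k l kl|k].
    by apply: le_truncn; rewrite ler_wpM2l// ler_nat.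
  by rewrite truncn_le mulr_ge0.
apply/lee_subgt0Pr => eta eta0; rewrite -EFinB; apply: code_rate_ge_squares => //.
(* [i >= a] gives [a * i ^ 2 <= i ^ 4 <= 2 ^ i]. The last bound makes [eta * i ^ 2] exceed
   [a * (i + 1) + 1], the loss from the longer time and from truncation. *)
exists (maxn 16 (maxn (Num.truncn a).+1 (Num.truncn ((2 * a + 1) / eta)).+1)) => i.
rewrite !geq_max => /and3P[i16 ai iE].
have {}ai : a <= i%:R by rewrite ltW// (lt_le_trans (truncnS_gt _))// ler_nat.
have {}iE : 2 * a + 1 <= i%:R * eta.
  rewrite -ler_pdivrMr// ltW// (lt_le_trans (truncnS_gt _))// ler_nat//.
have i1 : 1 <= i%:R :> R by rewrite ler1n (leq_trans _ i16).
split.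
  rewrite (leq_trans _ (exp4_le_exp2 i16))// -(ler_nat R).
  apply: le_trans (_ : a * (i ^ 2)%N%:R <= _); first by rewrite truncn_le mulr_ge0.
  apply: le_trans (_ : i%:R * (i ^ 2)%N%:R <= _); first by rewrite ler_wpM2r.
  by rewrite -natrM ler_nat -expnS leq_exp2l//; lia.
have := truncnS_gt (a * (i ^ 2)%N%:R); rewrite -natr1 !natrD natrX; nra.
Qed.

Theorem mainTheorem1 (R : realType) (a : \bar R) (a_ge0 : (0 <= a)%E) :
  exists (X : metricType R) (f : X -> X),
    [/\ [set: X] !=set0,
        compact [set: X],
        connected [set: X],
        homeomorphism f /\ pointwise_periodic f
      & pol_entropy f = a].
Proof.
have [r rE] : exists r : nat -> nat, pol_entropy (@code_map R r) = a.
  case: a a_ge0 => [a| |//]; rewrite ?lee_fin => a0.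
    (* For [a = 0] there are no spikes and the map is the identity of the segment. *)
    exists (fun k => Num.truncn (a * k%:R)).
    by apply: pol_entropyE => e e0 e1; exact: code_rate_finite.
  exists (fun k => k ^ 2)%N.
  by apply: pol_entropyE => e e0 e1; exact: code_rate_infinite.
exists (code_space r), (@code_map R r); split=> //.
- by exists (spike _ _ None 0).
- apply: hedgehog_compact; first exact: code_height_itv.
  exact: code_weight_small.
- exact: hedgehog_connected.
- split; last exact/hedgehog_map_pointwise_periodic/code_shift_pointwise_periodic.
  apply: hedgehog_map_homeomorphism (@code_shiftK r) (@code_unshiftK r) _ _ => //.
    exact: code_height_itv.
  exact: code_height_shift.
Qed.
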